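(* Let $S$ be a finite semigroup generated by a finite alphabet $A$, let $T=\mathsf{KR}_{\mathrm{right}}(S,A)$, and let $(\mathcal{C},[0,\mathbbm{1}])$ be the Chiswell tree of $T^{\mathbbm{1}}$, with vertices $[k,\beta]$ ($0\leqslant k\leqslant\ell$, $\beta\in T^{\mathbbm{1}}$). Then $$[k,\beta]\,\alpha=[k,\beta\alpha]\qquad(\alpha,\beta\in T^{\mathbbm{1}},\ 0\leqslant k\leqslant \ell)$$ is a well-defined right action of $T^{\mathbbm{1}}$ on $\mathcal{C}$, and the map sending $\alpha\in T^{\mathbbm{1}}$ to the function $[k,\beta]\mapsto[k,\beta\alpha]$ is an injective monoid homomorphism $$\epsilon'\colon T^{\mathbbm{1}}\to\big(\mathrm{EM}(\mathcal{C},[0,\mathbbm{1}])\big)^{\mathrm{op}},$$ where $\mathrm{EM}(\mathcal{C},[0,\mathbbm{1}])$ is the monoid of elliptic maps of the rooted tree $(\mathcal{C},[0,\mathbbm{1}])$.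
   Context: Generators: $A$ is a finite alphabet, $A^+$ is the free semigroup on $A$. ''$S$ is generated by $A$'' means that a surjective semigroup morphism $\theta\colon A^+\to S$ is fixed; words over $A$ also denote their images in $S$. Adjoined identity: for a semigroup $S$, $S^{\mathbbm{1}}$ is the monoid obtained by adjoining a new identity $\mathbbm{1}$ to $S$ (even if $S$ already is a monoid). The empty word represents $\mathbbm{1}$. Right Cayley graph: $\mathsf{RCay}(S,A)$ is the directed $A$-labeled graph with vertex set $S^{\mathbbm{1}}$ and edges $(s,a,sa)$ for $s\in S^{\mathbbm{1}}$, $a\in A$. An edge $(s,a,s')$ is a transition edge if there is no path from $s'$ to $s$. Karnofsky--Rhodes expansion: let $\tau_r$ be the congruence on $A^+$ defined by $u\,\tau_r\,v$ if $u=v$ holds in $S$ and the paths starting at $\mathbbm{1}$ with labels $u$ and $v$ in $\mathsf{RCay}(S,A)$ have the same transition edges. Then $T=\mathsf{KR}_{\mathrm{right}}(S,A)=A^+/\tau_r$, and $T^{\mathbbm{1}}=\mathsf{KR}^{\mathbbm{1}}_{\mathrm{right}}(S,A)$. Height: for $a,b\in S^{\mathbbm{1}}$, $a\leqslant_{\mathcal{J}}b$ means $a\in S^{\mathbbm{1}}bS^{\mathbbm{1}}$, and $a<_{\mathcal{J}}b$ means $a\leqslant_{\mathcal{J}}b$ but not $b\leqslant_{\mathcal{J}}a$. The Dedekind height function is $h(s)=\max\{k\in\mathbb{N}\mid \text{there is a chain } s_0>_{\mathcal{J}}\cdots>_{\mathcal{J}}s_k=s \text{ in } S^{\mathbbm{1}}\}$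 for $s\in S^{\mathbbm{1}}$. Put $\ell=2\max\{h(s)\mid s\in S^{\mathbbm{1}}\}$. Lyndon--Chiswell length function: the sequence of transition edges of $\alpha\in T^{\mathbbm{1}}$ is the sequence, in order, of the transition edges on the path from $\mathbbm{1}$ in $\mathsf{RCay}(S,A)$ labeled by any word representing $\alpha$ (empty if $\alpha=\mathbbm{1}$). Write $t(E)$ for the endpoint (target) of an edge $E$. Given $\alpha,\beta\in T^{\mathbbm{1}}$ with sequences $(E_1,\dots,E_m)$ and $(E'_1,\dots,E'_n)$, let $k=\xi(\alpha,\beta)$ be the largest $i\geqslant 0$ (with $i\leqslant m,n$) such that $E_1=E'_1,\dots,E_i=E'_i$. Then $D\colon T^{\mathbbm{1}}\times T^{\mathbbm{1}}\to\mathbb{N}$ is defined by: $D(\alpha,\beta)=\ell$ if $\alpha=\beta$; $D(\alpha,\beta)=0$ if $\alpha\neq\beta$ and $k=0$; $D(\alpha,\beta)=2h(t(E_k))$ if $\alpha\neq\beta$, $0<k<m$, $k<n$ and $t(E_{k+1})=t(E'_{k+1})$; $D(\alpha,\beta)=2h(t(E_k))-1$ in all remaining cases. Chiswell tree: on $C=\{(k,\alpha)\mid 0\leqslant k\leqslant\ell,\ \alpha\in T^{\mathbbm{1}}\}$ let $(k,\alpha)\sim(k',\beta)$ if $k=k'$ and $D(\alpha,\beta)\geqslant k$; this is an equivalence relation, and $[k,\alpha]$ denotes the class of $(k,\alpha)$. $\mathcal{C}$ is the undirected graph whose vertices are the classes $[k,\alpha]$, with an edge between $[k,\alpha]$ and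 $[k+1,\alpha]$ whenever $0\leqslant k<\ell$ and $\alpha\in T^{\mathbbm{1}}$. The pair $(\mathcal{C},[0,\mathbbm{1}])$ is a rooted tree with root $[0,\mathbbm{1}]$, called the Chiswell tree. Elliptic maps: for a rooted tree $(\Gamma,v_0)$ with vertex set $V$, let $\delta(v)$ be the length of the shortest path from $v$ to $v_0$. An elliptic map is a function $f\colon V\to V$ with $\delta(f(v))=\delta(v)$ for all $v\in V$ and sending adjacent vertices to adjacent vertices. $\mathrm{EM}(\Gamma,v_0)$ is the monoid of all elliptic maps under composition $(fg)(v)=f(g(v))$, and $\mathrm{EM}(\Gamma,v_0)^{\mathrm{op}}$ is the opposite monoid (maps compose from left to right). *)

(* Defs.v *)
From HB Require Import structures.
From mathcomp Require Import all_boot.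
From mathcomp Require Import generic_quotient boolp.

Set Implicit Arguments.
Unset Strict Implicit.
Unset Printing Implicit Defensive.

Local Open Scope group_scope.
Local Open Scope nat_scope.
Local Open Scope quotient_scope.

#[short(type="finSemigroupType")]
HB.structure Definition FinSemigroup := {S of Semigroup S & Finite S}.

(* The monoid obtained from S by adjoining a new identity None, even when S
   already has an identity. *)
Definition adj1 (S : Type) : Type := option S.

HB.instance Definition _ (S : choiceType) := Choice.copy (adj1 S) (option S).
HB.instance Definition _ (S : finType) := Finite.copy (adj1 S) (option S).

Section AdjoinedIdentity.
Variable S : semigroupType.

Definition adj1_mul (x y : adj1 S) : adj1 S :=
  match x, y with
  | None, _ => y
  | _, None => x
  | Some s, Some t => Some (s * t)%g
  end.

Fact adj1_mulA : associative adj1_mul.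
Proof. by move=> [x|] [y|] [z|] //=; rewrite mulgA. Qed.

Fact adj1_mul1g : left_id None adj1_mul.
Proof. by case. Qed.

Fact adj1_mulg1 : right_id None adj1_mul.
Proof. by case. Qed.

HB.instance Definition _ :=
  isMonoid.Build (adj1 S) adj1_mulA adj1_mul1g adj1_mulg1.

End AdjoinedIdentity.

Record free_semigroup (A : choiceType) :=
  FreeSemigroup { word : seq A; word_neq0 : word != [::] }.

HB.instance Definition _ (A : choiceType) := [isSub for @word A].
HB.instance Definition _ (A : choiceType) :=
  [Choice of free_semigroup A by <:].

Section FreeSemigroup.
Variable A : choiceType.
Implicit Types u v w : free_semigroup A.

Fact fs_mul_subproof u v : word u ++ word v != [::].
Proof. by case: u => -[|a u]. Qed.

Definition fs_mul u v := FreeSemigroup (fs_mul_subproof u v).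

Fact fs_mulA : associative fs_mul.
Proof. by move=> u v w; apply: val_inj; rewrite /= catA. Qed.

HB.instance Definition _ := isSemigroup.Build (free_semigroup A) fs_mulA.

Definition letter (a : A) : free_semigroup A := @FreeSemigroup A [:: a] isT.

End FreeSemigroup.

(* "S is generated by A": a surjective morphism from the free semigroup is part
   of the data. *)
Record generation (A : choiceType) (S : semigroupType) := Generation {
  gen_morph :> {multiplicative free_semigroup A -> S};
  gen_surj : forall s : S, exists w : free_semigroup A, gen_morph w = s
}.

Section Height.
Variable S : finSemigroupType.
Implicit Types a b s : adj1 S.

Definition leJ a b := [exists x : adj1 S, exists y : adj1 S, a == (x * b * y)%g].
Definition ltJ a b := leJ a b && ~~ leJ b a.

(* The chain s_0 > ... > s_k = s is stored as the tuple (s_0, ..., s_k); the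
   default value of [last] is never used. *)
Definition chain_to s k :=
  [exists c : (k.+1).-tuple (adj1 S),
    sorted (fun x y => ltJ y x) c && (last s c == s)].

Lemma leJ_refl : reflexive leJ.
Proof.
by move=> a; apply/existsP; exists 1%g; apply/existsP; exists 1%g;
  rewrite mulg1 mul1g.
Qed.

Lemma leJ_trans : transitive leJ.
Proof.
move=> b a c /existsP[x /existsP[y /eqP->]] /existsP[z /existsP[t /eqP->]].
apply/existsP; exists (x * z)%g; apply/existsP; exists (t * y)%g.
by rewrite !mulgA.
Qed.

Lemma ltJ_trans : transitive ltJ.
Proof.
move=> b a c /andP[ab nba] /andP[bc ncb]; rewrite /ltJ (leJ_trans ab bc) /=.
by apply: contra nba; apply: leJ_trans.
Qed.

Lemma ltJ_leJ_trans a b c : ltJ a b -> leJ b c -> ltJ a c.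
Proof.
move=> /andP[ab nba] bc; rewrite /ltJ (leJ_trans ab bc) /=.
by apply: contra nba; apply: leJ_trans.
Qed.

Fact chain_to_ex s : exists k, chain_to s k.
Proof. by exists 0; apply/existsP; exists [tuple s]; rewrite /= eqxx. Qed.

Fact chain_to_bound s k : chain_to s k -> k <= #|{: adj1 S}|.
Proof.
move=> /existsP[c /andP[sc _]]; have /card_uniqP : uniq c.
  apply: (sorted_uniq _ _ sc) => [y x z yx zy|x]; first exact: ltJ_trans zy yx.
  by rewrite /ltJ leJ_refl.
by rewrite size_tuple => ck; apply: ltnW; rewrite -ck max_card.
Qed.

Definition height s := ex_maxn (chain_to_ex s) (@chain_to_bound s).

Definition ell := 2 * \max_(s : adj1 S) height s.

Lemma height_ltJ a b : ltJ a b -> height b < height a.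
Proof.
move=> ab; rewrite {1}/height; case: ex_maxnP => k /existsP[c /andP[sc lc]] _.
rewrite /height; case: ex_maxnP => m _; apply; apply/existsP.
exists [tuple of rcons c a]; rewrite last_rcons eqxx andbT.
case: c sc lc => -[|x c] //= _ sc /eqP lc.
by rewrite rcons_path sc lc.
Qed.

Lemma stability s a : leJ s (s * a)%g -> exists z, s = (s * a * z)%g.
Proof.
move=> /existsP[x /existsP[y /eqP Es]]; pose b := (a * y)%g.
have Eb n : s = ((x ^+ n) * s * (b ^+ n))%g.
  elim: n => [|n IH]; first by rewrite !expg0 mul1g mulg1.
  rewrite {1}Es {1}IH expgSr expgS /b !mulgA.
  suff: (x * (x ^+ n) * s * (b ^+ n) * a * y = x ^+ n * x * s * a * y * b ^+ n)%g.
    by [].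
  have c1 : (x * x ^+ n = x ^+ n * x)%g by rewrite -expgS -expgSr.
  have c2 : (b ^+ n * (a * y) = (a * y) * b ^+ n)%g.
    by rewrite -expgS -expgSr.
  by rewrite c1 -!mulgA c2 !mulgA.
have [i [j [lij Eij]]] : exists i j, i < j /\ (b ^+ i = b ^+ j)%g.
  pose f (i : 'I_(#|{: adj1 S}|.+1)) := (b ^+ i)%g.
  have /injectivePn[i [j ij fij]] : ~~ injectiveb f.
    apply/negP => /injectiveP /leq_card; by rewrite card_ord ltnn.
  case: (ltngtP i j) => [lij|lji|/val_inj Eij].
  - by exists i, j.
  - by exists j, i.
  - by rewrite Eij eqxx in ij.
exists (y * b ^+ (j - i).-1)%g.
have -> : (s * a * (y * b ^+ (j - i).-1) = s * b ^+ (j - i))%g.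
  have -> : (j - i = (j - i).-1.+1)%N by rewrite prednK // subn_gt0.
  by rewrite expgS /b !mulgA.
by rewrite {2}(Eb i) -mulgA -expgnDr subnKC ?(ltnW lij) // -Eij.
Qed.

End Height.

Section KarnofskyRhodes.
Variables (A : finType) (S : finSemigroupType) (theta : generation A S).

Definition step (s : adj1 S) (a : A) : adj1 S := (s * Some (theta (letter a)))%g.

Definition rcay : rel (adj1 S) := fun s s' => [exists a, s' == step s a].

(* (source, label, target) *)
Definition edge : Type := (adj1 S * A * adj1 S)%type.
HB.instance Definition _ := Finite.on edge.

Definition src (E : edge) := E.1.1.
Definition tgt (E : edge) := E.2.

Fixpoint rcay_path (s : adj1 S) (w : seq A) : seq edge :=
  if w is a :: w' then (s, a, step s a) :: rcay_path (step s a) w' else [::].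

Definition transition (E : edge) := ~~ connect rcay (tgt E) (src E).

Definition trans_edges (w : seq A) : seq edge :=
  [seq E <- rcay_path 1%g w | transition E].

Definition tau_r (u v : free_semigroup A) :=
  (theta u == theta v) &&
  ([set E in trans_edges (word u)] == [set E in trans_edges (word v)]).

Fact tau_r_refl : reflexive tau_r.
Proof. by move=> u; rewrite /tau_r !eqxx. Qed.

Fact tau_r_sym : symmetric tau_r.
Proof.
by move=> u v; rewrite /tau_r (eq_sym (theta _)) (eq_sym [set E in _]).
Qed.

Fact tau_r_trans : transitive tau_r.
Proof.
by move=> v u w /andP[/eqP uv /eqP Euv] /andP[vw Evw]; rewrite /tau_r uv Euv vw.
Qed.

Canonical tau_r_equiv := EquivRel tau_r tau_r_refl tau_r_sym tau_r_trans.

Lemma foldl_step (s : adj1 S) (w : free_semigroup A) :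
  foldl step s (word w) = (s * Some (theta w))%g.
Proof.
case: w => w nw; elim: w nw s => [//|a w IH] nw s.
case: w IH nw => [|b w] IH nw.
  by rewrite /= /step; have -> : letter a = FreeSemigroup nw by apply: val_inj.
have nbw : b :: w != [::] by [].
change (foldl step (step s a) (b :: w) =
  (s * Some (theta (FreeSemigroup nw)))%g).
rewrite (IH nbw) /step -mulgA.
have -> : FreeSemigroup nw = (letter a * FreeSemigroup nbw)%g by apply: val_inj.
by rewrite gmulfM.
Qed.

Lemma rcay_path_cat s u v :
  rcay_path s (u ++ v) = rcay_path s u ++ rcay_path (foldl step s u) v.
Proof. by elim: u s => //= a u IH s; rewrite IH. Qed.

Definition lmul_edge (x : adj1 S) (E : edge) : edge :=
  ((x * src E)%g, E.1.2, (x * tgt E)%g).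

Lemma rcay_path_lmul x s w :
  rcay_path (x * s)%g w = map (lmul_edge x) (rcay_path s w).
Proof.
elim: w s => //= a w IH s.
by have -> : step (x * s)%g a = (x * step s a)%g; rewrite ?IH // /step mulgA.
Qed.

Lemma connect_lmul x s s' :
  connect rcay s s' -> connect rcay (x * s)%g (x * s')%g.
Proof.
move=> /connectP[p]; elim: p s => [|r p IH] s /=; first by move=> _ ->.
case/andP=> /existsP[a /eqP Er] pp Es'; apply: connect_trans (IH _ pp Es').
by apply/connect1/existsP; exists a; rewrite Er /step mulgA.
Qed.

Lemma transition_lmul x E : transition (lmul_edge x E) -> transition E.
Proof. by apply: contra; apply: connect_lmul. Qed.

Lemma tau_r_mull w u v : tau_r u v -> tau_r (w * u)%g (w * v)%g.
Proof.
case/andP=> /eqP uv /eqP Euv; rewrite /tau_r !gmulfM uv eqxx /=; apply/eqP.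
apply/setP=> E; rewrite !inE /trans_edges /= !rcay_path_cat !filter_cat !mem_cat.
congr (_ || _); rewrite foldl_step mul1g -[Some _](@mulg1 (adj1 S)).
rewrite !rcay_path_lmul.
rewrite !mem_filter; case: (boolP (transition E)) => //= tE.
have uvP F : transition F ->
    (F \in rcay_path 1%g (word u)) = (F \in rcay_path 1%g (word v)).
  by move=> tF; move/setP/(_ F): Euv; rewrite !inE !mem_filter tF.
apply/mapP/mapP => -[F inF EF]; exists F => //; rewrite EF in tE.
- by rewrite -uvP // (transition_lmul tE).
- by rewrite uvP // (transition_lmul tE).
Qed.

Lemma tau_r_mulr w u v : tau_r u v -> tau_r (u * w)%g (v * w)%g.
Proof.
case/andP=> /eqP uv /eqP Euv; rewrite /tau_r !gmulfM uv eqxx /=; apply/eqP.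
apply/setP=> E; rewrite !inE /trans_edges /= !rcay_path_cat !filter_cat !mem_cat.
by rewrite !foldl_step uv; congr (_ || _); move/setP/(_ E): Euv; rewrite !inE.
Qed.

Definition KR := {eq_quot tau_r}.
HB.instance Definition _ := Choice.on KR.
HB.instance Definition _ := EqQuotient.on KR.

Definition KR_mul (x y : KR) : KR := \pi_KR (repr x * repr y)%g.

Lemma KR_mul_pi (u v : free_semigroup A) :
  KR_mul (\pi u) (\pi v) = \pi_KR (u * v)%g.
Proof.
apply/eqmodP; case: piP => u' /eqmodP uu'; case: piP => v' /eqmodP vv'.
apply: tau_r_trans (tau_r_mull u' (_ : tau_r v' v)) (tau_r_mulr v _).
  by rewrite tau_r_sym.
by rewrite tau_r_sym.
Qed.

Fact KR_mulA : associative KR_mul.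
Proof.
move=> x y z; rewrite -[x]reprK -[y]reprK -[z]reprK.
by rewrite !KR_mul_pi mulgA.
Qed.

HB.instance Definition _ := isSemigroup.Build KR KR_mulA.

Definition trans_seq (alpha : adj1 KR) : seq edge :=
  if alpha is Some t then trans_edges (word (repr t)) else [::].

Let is_edge (E : edge) := tgt E == step (src E) E.1.2.

Let ltE (E F : edge) :=
  [&& is_edge E, is_edge F, transition E, transition F
    & connect rcay (tgt E) (src F)].

Let ltE_irr : irreflexive ltE.
Proof. by move=> E; apply/negP => /and5P[_ _ /negP]. Qed.

Let ltE_trans : transitive ltE.
Proof.
move=> F E G /and5P[eE eF tE tF EF] /and5P[_ eG _ tG FG].
rewrite /ltE eE eG tE tG /=; apply: connect_trans EF (connect_trans _ FG).
by apply/connect1/existsP; exists F.1.2.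
Qed.

Let rcay_path_connect s w E :
  E \in rcay_path s w -> is_edge E && connect rcay s (src E).
Proof.
elim: w s => //= a w IH s; rewrite inE => /orP[/eqP->|/IH/andP[-> sE]].
  by rewrite /is_edge eqxx connect0.
by apply: connect_trans sE; apply/connect1/existsP; exists a.
Qed.

Let trans_sorted s w : sorted ltE [seq E <- rcay_path s w | transition E].
Proof.
rewrite sorted_pairwise //; elim: w s => //= a w IH s.
case: ifP => //= tE; rewrite IH andbT; apply/allP => F.
rewrite mem_filter => /andP[tF /rcay_path_connect/andP[eF cF]].
by rewrite /ltE /is_edge eqxx tE tF cF /= andbT; apply: eF.
Qed.

(* The sequence of transition edges does not depend on the chosen word. *)
Lemma trans_seq_pi (w : free_semigroup A) :
  trans_seq (Some (\pi_KR w)) = trans_edges (word w).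
Proof.
rewrite /trans_seq; case: piP => u /eqmodP/andP[_ /eqP Ewu].
apply: (irr_sorted_eq ltE_trans ltE_irr); rewrite ?trans_sorted //.
by move=> E; move/setP/(_ E): Ewu; rewrite !inE.
Qed.

Lemma connect_leJ s s' : connect rcay s s' -> leJ s' s.
Proof.
move=> /connectP[p]; elim: p s => [|r p IH] s /=; first by move=> _ ->; exact: leJ_refl.
case/andP=> /existsP[a /eqP Er] pp Es'; apply: leJ_trans (IH _ pp Es') _.
apply/existsP; exists 1%g; apply/existsP; exists (Some (theta (letter a))).
by rewrite mul1g Er.
Qed.

Lemma connect_mulr (s z : adj1 S) : connect rcay s (s * z)%g.
Proof.
case: z => [z|]; last by rewrite (mulg1 s : (s * None)%g = s).
have [w <-] := gen_surj theta z; rewrite -foldl_step.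
elim: (word w) s => //= a v IH s; apply: connect_trans (IH _).
by apply/connect1/existsP; exists a.
Qed.

Lemma transition_ltJ E : is_edge E -> transition E -> ltJ (tgt E) (src E).
Proof.
move=> /eqP eE tE; apply/andP; split.
  by apply/connect_leJ; rewrite eE; apply: connect_mulr.
apply: contra tE; rewrite eE => /stability[z Ez]; rewrite {2}Ez -eE eE.
exact: connect_mulr.
Qed.

Lemma trans_seq_height (alpha : adj1 KR) :
  path (fun i j => i < j) 0 [seq height (tgt E) | E <- trans_seq alpha].
Proof.
case: alpha => [t|] //=; rewrite /trans_edges.
have := trans_sorted 1%g (word (repr t)).
have : all (fun E => is_edge E && transition E)
           [seq E <- rcay_path 1%g (word (repr t)) | transition E].
  by apply/allP=> E; rewrite mem_filter => /andP[-> /rcay_path_connect/andP[->]].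
case: [seq E <- _ | _] => //= E p /andP[/andP[eE tE] _] sp; apply/andP; split.
  exact: leq_ltn_trans (leq0n _) (height_ltJ (transition_ltJ eE tE)).
apply: (homo_path (f := fun E => height (tgt E)) _ sp).
move=> {sp eE tE} {}E F /and5P[_ eF _ tF EF].
apply: height_ltJ; apply: ltJ_leJ_trans (transition_ltJ eF tF) _.
exact: connect_leJ.
Qed.

End KarnofskyRhodes.

Section LyndonChiswell.
Variables (A : finType) (S : finSemigroupType) (theta : generation A S).
Implicit Types (s t : seq (edge A S)) (alpha beta gamma : adj1 (KR theta)).

(* t(E_i), for a sequence of edges indexed from 1; junk unless
   0 < i <= size s. *)
Definition endpoint s i : adj1 S := nth 1%g [seq tgt E | E <- s] i.-1.

Definition xi s t := \max_(i < (minn (size s) (size t)).+1 | take i s == take i t) i.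

(* The subtraction never truncates: height (endpoint s k) > 0 for k > 0. *)
Definition lyndon_chiswell alpha beta : nat :=
  let s := trans_seq alpha in
  let t := trans_seq beta in
  let k := xi s t in
  if alpha == beta then ell S
  else if k == 0 then 0
  else if [&& k < size s, k < size t & endpoint s k.+1 == endpoint t k.+1]
  then 2 * height (endpoint s k)
  else 2 * height (endpoint s k) - 1.

Let xi_spec s t :
  [/\ xi s t <= size s, xi s t <= size t & take (xi s t) s = take (xi s t) t].
Proof.
rewrite /xi; have [|i /eqP Ei ->] := @eq_bigmax_cond _
    [pred i : 'I_(minn (size s) (size t)).+1 | take i s == take i t] (@nat_of_ord _).
  by apply/card_gt0P; exists ord0; rewrite inE /= !take0.
by have := ltn_ord i; rewrite ltnS leq_min => /andP[].
Qed.

Let xi_max s t i :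
  i <= size s -> i <= size t -> take i s = take i t -> i <= xi s t.
Proof.
move=> si ti Ei; have li : i < (minn (size s) (size t)).+1.
  by rewrite ltnS leq_min si.
by rewrite -[i]/(nat_of_ord (Ordinal li)); apply: leq_bigmax_cond; rewrite /= Ei.
Qed.

Let xiC s t : xi s t = xi t s.
Proof.
have [s1 t1 E1] := xi_spec s t; have [s2 t2 E2] := xi_spec t s.
by apply/eqP; rewrite eqn_leq !xi_max.
Qed.

Let endpoint_take s t j i : 0 < i <= j -> take j s = take j t ->
  endpoint s i = endpoint t i.
Proof.
case/andP=> i0 ij Est; rewrite /endpoint -(nth_take _ (n0 := j)) ?prednK //.
by rewrite -map_take Est map_take nth_take ?prednK.
Qed.

Let height_endpoint alpha i j : i < j <= size (trans_seq alpha) ->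
  (if i is 0 then 0 else height (endpoint (trans_seq alpha) i)) <
  height (endpoint (trans_seq alpha) j).
Proof.
set s := trans_seq alpha; case/andP=> ij js.
have hE k : 0 < k <= size s ->
    height (endpoint s k) = nth 0 (0 :: [seq height (tgt E) | E <- s]) k.
  case: k => // k /= ks; rewrite /endpoint /=.
  by rewrite (map_comp (@height S) (@tgt A S)) (nth_map 1%g) ?size_map.
have -> : (if i is 0 then 0 else height (endpoint s i)) =
    nth 0 (0 :: [seq height (tgt E) | E <- s]) i.
  by case: i ij => // i ij; rewrite hE //= (leq_trans (ltnW ij)).
rewrite hE ?js ?andbT; last exact: leq_ltn_trans ij.
have sh : sorted ltn (0 :: [seq height (tgt E) | E <- s]).
  exact: trans_seq_height.
apply: (sorted_ltn_nth ltn_trans 0 sh) => //; rewrite inE /= size_map ltnS //.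
exact: leq_trans (ltnW ij) js.
Qed.

(* For distinct elements, D(alpha, beta) >= j is witnessed by some common
   prefix, not necessarily the longest one. *)
Definition close j s t :=
  j = 0 \/ exists i, [/\ 0 < i, i <= size s, i <= size t, take i s = take i t
    & j <= 2 * height (endpoint s i) - 1 \/
      [/\ i < size s, i < size t, endpoint s i.+1 = endpoint t i.+1
        & j <= 2 * height (endpoint s i)]].

Lemma lyndon_chiswellP j alpha beta : alpha != beta ->
  (j <= lyndon_chiswell alpha beta) <->
  close j (trans_seq alpha) (trans_seq beta).
Proof.
move=> /negbTE neq; rewrite /lyndon_chiswell neq.
set s := trans_seq alpha; set t := trans_seq beta.
have [ks kt Ek] := xi_spec s t; set k := xi s t in ks kt Ek *.
split.
  case: (posnP k) => [k0|k0]; first by rewrite leqn0 => /eqP; left.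
  move=> jle; right; exists k; split=> //; move: jle.
  by case: and3P => [[ks' kt' /eqP Ee]|_]; [right|left].
case=> [->//|[i [i0 si ti Ei jle]]].
have ik : i <= k by apply: xi_max.
have k0 : 0 < k by apply: leq_trans ik.
rewrite eqn0Ngt k0 /=.
have Ei' : endpoint s i = endpoint s i by [].
case: (ltngtP i k) ik => // [ik _|Eik _].
  have hik : height (endpoint s i) < height (endpoint s k).
    have := @height_endpoint alpha i k; rewrite ik ks => /(_ isT).
    by case: (i) i0.
  have le2 : j <= 2 * height (endpoint s i).
    by case: jle => [/leq_trans-> //|[]//]; rewrite leq_subr.
  have le3 : 2 * height (endpoint s i) <= 2 * height (endpoint s k) - 1.
    by rewrite leq_subRL ?muln_gt0 ?(leq_ltn_trans _ hik) // addnC addn1 ltn_mul2l.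
  apply: leq_trans le2 (leq_trans le3 _).
  by case: ifP => // _; rewrite leq_subr.
rewrite -Eik; case: jle => [jle|[si' ti' Ee jle]].
  by case: ifP => // _; apply: leq_trans jle (leq_subr _ _).
by rewrite si' ti' Ee eqxx.
Qed.

Lemma lyndon_chiswellC alpha beta :
  lyndon_chiswell alpha beta = lyndon_chiswell beta alpha.
Proof.
rewrite /lyndon_chiswell eq_sym xiC; case: eqP => // _.
set s := trans_seq alpha; set t := trans_seq beta.
have [_ _ Ek] := xi_spec t s; case: (posnP (xi t s)) => // k0.
rewrite (endpoint_take (i := xi t s) _ (esym Ek)) ?k0 ?leqnn //.
by rewrite (eq_sym (endpoint s _)) andbCA.
Qed.

Lemma lyndon_chiswell_ultra j alpha beta gamma : j <= ell S ->
  j <= lyndon_chiswell alpha beta -> j <= lyndon_chiswell beta gamma ->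
  j <= lyndon_chiswell alpha gamma.
Proof.
move=> jl; have [-> //|ab] := eqVneq alpha beta.
have [-> //|bc] := eqVneq beta gamma.
have [<- _ _|ac] := eqVneq alpha gamma; first by rewrite /lyndon_chiswell eqxx.
rewrite !lyndon_chiswellP //.
set s := trans_seq alpha; set t := trans_seq beta; set u := trans_seq gamma.
case=> [->|[i [i0 si ti Ei jlei]]]; first by left.
case=> [->|[k [k0 tk uk Ek jlek]]]; first by left.
right; have Est : endpoint s i = endpoint t i.
  by apply: endpoint_take Ei; rewrite i0 leqnn.
have Etu : endpoint t k = endpoint u k.
  by apply: endpoint_take Ek; rewrite k0 leqnn.
case: (ltngtP i k) => [ik|ki|Eik].
- have Esu : take i s = take i u.
    by rewrite Ei -(take_takel u (ltnW ik)) -Ek take_takel // ltnW.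
  exists i; split=> //; first exact: leq_trans (ltnW ik) uk.
  case: jlei => [|[si' ti' Ee jle]]; first by left.
  right; split=> //; first exact: leq_trans ik uk.
  by rewrite Ee; apply: endpoint_take Ek.
- have Esu : take k s = take k u.
    by rewrite -Ek -(take_takel s (ltnW ki)) Ei take_takel // ltnW.
  have Esk : endpoint s k = endpoint t k.
    by apply: endpoint_take Ei; rewrite k0 ltnW.
  exists k; split=> //; first exact: leq_trans (ltnW ki) si.
  rewrite Esk; case: jlek => [|[tk' uk' Ee jle]]; first by left.
  right; split=> //; first exact: leq_trans ki si.
  by rewrite -Ee; apply: endpoint_take Ei.
- rewrite -Eik in k0 tk uk Ek jlek Etu *.
  exists i; split=> //; first by rewrite Ei.
  case: jlei => [|[si' ti' Ee jle]]; first by left.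
  case: jlek => [|[tk' uk' Ee' jle']]; first by rewrite -Est; left.
  by right; split=> //; rewrite Ee.
Qed.

End LyndonChiswell.

(* A tree, as a connected simple graph without cycles, with a root. *)
Record rooted_tree := RootedTree {
  vertex :> choiceType;
  adj : rel vertex;
  root : vertex;
  adj_sym : symmetric adj;
  adj_irr : irreflexive adj;
  tree_connected : forall u v : vertex,
    exists p : seq vertex, path adj u p /\ last u p = v;
  tree_acyclic : forall c : seq vertex, 2 < size c -> uniq c -> ~~ cycle adj c
}.

Section EllipticMaps.
Variable G : rooted_tree.

Definition walk_to_root (v : G) (n : nat) : Prop :=
  exists p : seq G, [/\ path (@adj G) v p, last v p = root G & size p = n].

Fact walk_to_root_ex v : exists n, `[< walk_to_root v n >].
Proof.
have [p [vp pr]] := tree_connected v (root G).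
by exists (size p); apply/asboolP; exists p.
Qed.

(* Distance to the root. *)
Definition depth (v : G) : nat := ex_minn (walk_to_root_ex v).

Definition elliptic (f : G -> G) : Prop :=
  (forall v, depth (f v) = depth v) /\
  (forall u v, adj u v -> adj (f u) (f v)).

Record elliptic_map := EllipticMap {
  em_fun :> G -> G;
  em_elliptic : `[< elliptic em_fun >]
}.

HB.instance Definition _ := [isSub for em_fun].
HB.instance Definition _ := [Choice of elliptic_map by <:].

Fact em_one_subproof : `[< elliptic (@id G) >].
Proof. exact/asboolP. Qed.

Definition em_one := EllipticMap em_one_subproof.

Fact em_mul_subproof (f g : elliptic_map) : `[< elliptic (fun v => f (g v)) >].
Proof.
apply/asboolP; case: f g => [f /= /asboolP[fd fa]] [g /= /asboolP[gd ga]].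
by split=> [v|u v uv]; rewrite ?fd ?gd //; apply/fa/ga.
Qed.

Definition em_mul (f g : elliptic_map) := EllipticMap (em_mul_subproof f g).

Fact em_mulA : associative em_mul.
Proof. by move=> f g h; apply: val_inj. Qed.

Fact em_mul1g : left_id em_one em_mul.
Proof. by move=> f; apply: val_inj. Qed.

Fact em_mulg1 : right_id em_one em_mul.
Proof. by move=> f; apply: val_inj. Qed.

HB.instance Definition _ := isMonoid.Build elliptic_map em_mulA em_mul1g em_mulg1.

End EllipticMaps.

(* M with the multiplication reversed. *)
Definition opposite (M : Type) : Type := M.

HB.instance Definition _ (M : choiceType) := Choice.copy (opposite M) M.

Section Opposite.
Variable M : monoidType.

Definition opposite_mul (x y : opposite M) : opposite M := ((y : M) * (x : M))%g.

Fact opposite_mulA : associative opposite_mul.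
Proof. by move=> x y z; rewrite /opposite_mul mulgA. Qed.

Fact opposite_mul1g : left_id (1%g : M) opposite_mul.
Proof. by move=> x; apply: mulg1. Qed.

Fact opposite_mulg1 : right_id (1%g : M) opposite_mul.
Proof. by move=> x; apply: mul1g. Qed.

HB.instance Definition _ :=
  isMonoid.Build (opposite M) opposite_mulA opposite_mul1g opposite_mulg1.

End Opposite.

Definition right_action (M : monoidType) (X : Type) (act : X -> M -> X) : Prop :=
  (forall x, act x 1%g = x) /\
  (forall x a b, act x (a * b)%g = act (act x a) b).

Section ChiswellTree.
Variables (A : finType) (S : finSemigroupType) (theta : generation A S).
Implicit Types alpha beta : adj1 (KR theta).

Definition chiswell_pair := ('I_(ell S).+1 * adj1 (KR theta))%type.
HB.instance Definition _ := Choice.on chiswell_pair.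

Definition chiswell_eqv (x y : chiswell_pair) :=
  (x.1 == y.1) && (x.1 <= lyndon_chiswell x.2 y.2).

Fact chiswell_eqv_refl : reflexive chiswell_eqv.
Proof.
by move=> [k a]; rewrite /chiswell_eqv /lyndon_chiswell /= !eqxx -ltnS ltn_ord.
Qed.

Fact chiswell_eqv_sym : symmetric chiswell_eqv.
Proof.
move=> [k a] [l b]; rewrite /chiswell_eqv /= lyndon_chiswellC eq_sym.
by case: eqP => // ->.
Qed.

Fact chiswell_eqv_trans : transitive chiswell_eqv.
Proof.
move=> [l b] [k a] [m c] /andP[/= /eqP<- ab] /andP[/= /eqP<- bc].
rewrite /chiswell_eqv /= eqxx (lyndon_chiswell_ultra _ ab bc) //.
by rewrite -ltnS ltn_ord.
Qed.

Canonical chiswell_equiv :=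
  EquivRel chiswell_eqv chiswell_eqv_refl chiswell_eqv_sym chiswell_eqv_trans.

Definition chiswell_vertex := {eq_quot chiswell_eqv}.
HB.instance Definition _ := Choice.on chiswell_vertex.
HB.instance Definition _ := EqQuotient.on chiswell_vertex.

(* The vertex [k, alpha]. *)
Definition chiswell_class (k : 'I_(ell S).+1) alpha : chiswell_vertex :=
  \pi_chiswell_vertex (k, alpha).

Definition chiswell_edge (u v : chiswell_vertex) : Prop :=
  exists (k : 'I_(ell S)) alpha,
    u = chiswell_class (widen_ord (leqnSn _) k) alpha /\
    v = chiswell_class (lift ord0 k) alpha.

Definition chiswell_adj (u v : chiswell_vertex) : bool :=
  `[< chiswell_edge u v \/ chiswell_edge v u >].

Definition chiswell_root : chiswell_vertex := chiswell_class ord0 1%g.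

Lemma chiswell_classP (k l : 'I_(ell S).+1) alpha beta :
  chiswell_class k alpha = chiswell_class l beta <->
  k = l /\ k <= lyndon_chiswell alpha beta.
Proof.
split=> [/eqmodP/andP[/eqP]|[<- kab]] //.
by apply/eqmodP; rewrite /= /chiswell_eqv /= eqxx.
Qed.

Lemma chiswell_vertexP (v : chiswell_vertex) :
  exists k alpha, v = chiswell_class k alpha.
Proof. by elim/quotW: v => -[k a]; exists k, a. Qed.

Let level (v : chiswell_vertex) : nat := (repr v).1.

Let level_class k alpha : level (chiswell_class k alpha) = k.
Proof.
by rewrite /level /chiswell_class; case: piP => -[l b] /chiswell_classP[<-].
Qed.

Let level_edge u v : chiswell_edge u v -> level v = (level u).+1.
Proof. by move=> [k [a [-> ->]]]; rewrite !level_class. Qed.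

Let edge_parent u u' v : chiswell_edge u v -> chiswell_edge u' v -> u = u'.
Proof.
move=> [k [a [-> ->]]] [l [b [-> /chiswell_classP[/lift_inj <- kab]]]].
by apply/chiswell_classP; split=> //; apply: ltnW kab.
Qed.

Fact chiswell_adj_sym : symmetric chiswell_adj.
Proof. by move=> u v; apply/asboolP/asboolP => -[]; [right|left|right|left]. Qed.

Fact chiswell_adj_irr : irreflexive chiswell_adj.
Proof.
move=> v; apply/negP => /asboolP[] /level_edge /eqP;
  by rewrite eqn_leq ltnn andbF.
Qed.

Let to_root v :
  exists p, path chiswell_adj v p /\ last v p = chiswell_root.
Proof.
have [k [a ->]] := chiswell_vertexP v; case: k => k lk.
elim: k lk => [|k IH] lk.
  exists [::]; split=> //=; apply/chiswell_classP; split=> //; exact: val_inj.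
have lk' : k < (ell S).+1 by apply: ltnW.
have [p [pp lp]] := IH lk'; exists (chiswell_class (Ordinal lk') a :: p).
split=> //=; rewrite pp andbT; apply/asboolP; right.
exists (Ordinal (lk : k < ell S)), a.
by split; congr chiswell_class; apply: val_inj.
Qed.

Fact chiswell_connected u v : exists p, path chiswell_adj u p /\ last u p = v.
Proof.
have [p [up pr]] := to_root u; have [q [vq qr]] := to_root v.
exists (p ++ rev (belast v q)); rewrite cat_path last_cat up pr -qr rev_path.
split; first by rewrite /= (eq_path (e' := chiswell_adj)) // => x y; rewrite chiswell_adj_sym.
by case: q {vq qr} => //= x q; rewrite rev_cons last_rcons.
Qed.

Fact chiswell_acyclic (c : seq chiswell_vertex) :
  2 < size c -> uniq c -> ~~ cycle chiswell_adj c.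
Proof.
move=> sc uc; apply/negP => cc.
have [x xc xmax] : exists2 x, x \in c & {in c, forall y, level y <= level x}.
  elim: c sc uc cc => // x c; case: c => // y c _ _ _ _.
  elim: {y}(y :: c) x => [|y d IH] x; first by exists x; rewrite ?inE // => z; rewrite inE => /eqP->.
  have [z zd zmax] := IH x.
  have [yz|zy] := leqP (level y) (level z).
    exists z; first by move: zd; rewrite !inE => /orP[->//|->]; rewrite !orbT.
    move=> w; rewrite !inE orbCA => /orP[/eqP->//|wd].
    by apply: zmax; rewrite inE.
  exists y; first by rewrite !inE eqxx orbT.
  move=> w; rewrite !inE orbCA => /orP[/eqP->//|wd].
  by apply: leq_trans (ltnW zy); apply: zmax; rewrite inE.
have [i p Ec] := rot_to xc.
have up : uniq (x :: p) by rewrite -Ec rot_uniq.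
have cp : cycle chiswell_adj (x :: p) by rewrite -Ec rot_cycle.
have sp : 2 < size (x :: p) by rewrite -Ec size_rot.
have pmax y : y \in p -> level y <= level x.
  by move=> yp; apply: xmax; rewrite -(mem_rot i) Ec inE yp orbT.
have par y : level y <= level x -> chiswell_adj x y -> chiswell_edge y x.
  move=> yx /asboolP[]// /level_edge E.
  by rewrite E ltnn in yx.
case/lastP: p sp up cp pmax {Ec} => // p z; case: p => // y p _ up cp pmax.
have xy : chiswell_edge y x.
  apply: par; first by apply: pmax; rewrite inE eqxx.
  by move: cp => /= /andP[].
have xz : chiswell_edge z x.
  apply: par; first by apply: pmax; rewrite mem_rcons inE eqxx.
  move: cp; rewrite /= -cats1 cat_path /= last_rcons => /and3P[_ _ /andP[+ _]].
  by rewrite chiswell_adj_sym.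
move: up; rewrite (edge_parent xy xz) /= => /and3P[_ /negP].
by rewrite mem_rcons inE eqxx.
Qed.

Definition chiswell_tree : rooted_tree :=
  RootedTree chiswell_root chiswell_adj_sym chiswell_adj_irr
    chiswell_connected chiswell_acyclic.

End ChiswellTree.

(* Main.v *)
Require Import Defs.
From HB Require Import structures.
From mathcomp Require Import all_boot.
From mathcomp Require Import generic_quotient boolp.

Set Implicit Arguments.
Unset Strict Implicit.
Unset Printing Implicit Defensive.

(** Reading a word letter by letter only lengthens its path in the right Cayley
graph, so the sequence of transition edges of beta is a prefix of that of
beta * alpha [trans_seq_mul].  The Lyndon--Chiswell length D of two distinct
elements is bounded below through common prefixes of their sequences, and
lengthening both sequences keeps every such prefix, together with the endpoint
that follows it; hence right multiplication cannot decrease D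
[lyndon_chiswell_mulr].  This is exactly what makes the action on classes well
defined.

A vertex [k, beta] lies at distance k from the root [depth_class], because
every edge of the tree changes the first coordinate by one.  The action keeps
this coordinate and sends edges to edges, so each alpha acts by an elliptic
map.

The action is already faithful on the single vertex [ell, 1]: along a transition
sequence the heights of the endpoints strictly increase, so an endpoint
followed by another one has less than the maximal height, and D(alpha, beta)
reaches ell only if alpha = beta [lyndon_chiswell_ell]. *)

Section RightTranslation.
Local Open Scope quotient_scope.
Variables (A : finType) (S : finSemigroupType) (theta : generation A S).
Implicit Types (s t : seq (edge A S)) (alpha beta gamma : adj1 (KR theta)).

Lemma trans_seq_mul alpha gamma :
  exists s, trans_seq (alpha * gamma)%g = trans_seq alpha ++ s.
Proof.
case: alpha gamma => [x|] [y|]; last by exists [::].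
- change (exists s,
    trans_seq (Some (\pi_(KR theta) (repr x * repr y)%g))
    = trans_seq (Some x) ++ s).
  rewrite trans_seq_pi /trans_edges /= rcay_path_cat filter_cat.
  by eexists.
- by exists [::]; rewrite cats0.
- by exists (trans_seq (Some y)).
Qed.

Lemma endpoint_cat s t i : i.-1 < size s -> endpoint (s ++ t) i = endpoint s i.
Proof. by move=> si; rewrite /endpoint map_cat nth_cat size_map si. Qed.

(** The prefix witnessing closeness of s and t is still common to their
extensions; it need not be the longest common prefix there. *)
Lemma close_cat j s t s' t' : close j s t -> close j (s ++ s') (t ++ t').
Proof.
case=> [->|[i [i0 si ti Ei jle]]]; first by left.
have i1s : i.-1 < size s by rewrite prednK.
have le_cat (r r' : seq (edge A S)) : i <= size r -> i <= size (r ++ r').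
  by rewrite size_cat => ir; apply: leq_trans (leq_addr _ _).
right; exists i; rewrite !takel_cat // !le_cat //; split=> //.
rewrite endpoint_cat //; case: jle => [|[si' ti' Ee jle]]; first by left.
by right; rewrite !endpoint_cat // !size_cat !ltn_addr.
Qed.

(** Distinct alpha and beta either are merged by gamma, and then D takes its
value ell S on the diagonal, or stay distinct and [close_cat] applies. *)
Lemma lyndon_chiswell_mulr j alpha beta gamma : j <= ell S ->
  j <= lyndon_chiswell alpha beta ->
  j <= lyndon_chiswell (alpha * gamma)%g (beta * gamma)%g.
Proof.
move=> jl; have [<- _|ab] := eqVneq alpha beta.
  by rewrite /lyndon_chiswell eqxx.
have [<- _|agbg] := eqVneq (alpha * gamma)%g (beta * gamma)%g.
  by rewrite /lyndon_chiswell eqxx.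
rewrite !lyndon_chiswellP //.
have [s ->] := trans_seq_mul alpha gamma.
by have [t ->] := trans_seq_mul beta gamma; apply: close_cat.
Qed.

Lemma height_endpointS alpha i : 0 < i < size (trans_seq alpha) ->
  height (endpoint (trans_seq alpha) i)
  < height (endpoint (trans_seq alpha) i.+1).
Proof.
set s := trans_seq alpha; case: i => // i /= si.
have /(pathP 0)/(_ i.+1) := trans_seq_height alpha.
rewrite size_map (map_comp (@height S) (@tgt A S)) => /(_ si) /=.
by rewrite !(nth_map 1%g) ?size_map //; exact: ltnW.
Qed.

End RightTranslation.

Section Height.
Variable S : finSemigroupType.
Implicit Type x : adj1 S.

Lemma height_le_ell x : 2 * height x <= ell S.
Proof. by rewrite leq_mul2l; apply: leq_bigmax. Qed.

(** The adjoined identity lies strictly above every element of S. *)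
Lemma ell_gt0 (s : S) : 0 < ell S.
Proof.
apply: leq_trans (height_le_ell (Some s)); rewrite muln_gt0 /=.
apply: leq_ltn_trans (leq0n (height (1%g : adj1 S))) (height_ltJ _).
apply/andP; split.
  apply/existsP; exists 1%g; apply/existsP; exists (Some s).
  by rewrite !mul1g.
by apply/existsP => -[[x|] /existsP[[y|] /eqP]].
Qed.

End Height.

Section ChiswellAction.
Variables (A : finType) (S : finSemigroupType) (theta : generation A S).
Implicit Types (k : 'I_(ell S).+1) (alpha beta gamma : adj1 (KR theta)).
Implicit Types u v : chiswell_tree theta.

(** Every value of D at distinct elements is 0, at most 2h - 1 for some height
h, or 2h for the height h of an endpoint followed by a strictly higher one; all
of these are below ell S. *)
Lemma lyndon_chiswell_ell alpha beta :
  ell S <= lyndon_chiswell alpha beta -> alpha = beta.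
Proof.
have [//|ab] := eqVneq alpha beta; rewrite lyndon_chiswellP //.
have l0 : 0 < ell S.
  (* Distinct elements exist only if S is inhabited. *)
  case: alpha beta ab => [x|] [y|] // _.
  - exact: ell_gt0 (theta (repr x)).
  - exact: ell_gt0 (theta (repr x)).
  - exact: ell_gt0 (theta (repr y)).
case=> [l0'|[i [i0 _ _ _ ilast]]]; first by rewrite l0' in l0.
suff: ell S < ell S by rewrite ltnn.
case: ilast => [le|[si _ _ le]].
  apply: leq_trans (height_le_ell (endpoint (trans_seq alpha) i)).
  have := leq_trans l0 le; rewrite subn_gt0 => h1.
  by apply: leq_ltn_trans le _; rewrite subn1 prednK // ltnW.
apply: leq_trans (height_le_ell (endpoint (trans_seq alpha) i.+1)).
apply: leq_ltn_trans le _.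
by rewrite ltn_mul2l height_endpointS // i0.
Qed.

(** The action is computed on the chosen representative of a class;
[chiswell_act_class] shows that any other representative gives the same
vertex. *)
Definition chiswell_act v alpha : chiswell_tree theta :=
  chiswell_class (repr v).1 ((repr v).2 * alpha)%g.

Lemma chiswell_act_class k beta alpha :
  chiswell_act (chiswell_class k beta) alpha
  = chiswell_class k (beta * alpha)%g.
Proof.
rewrite /chiswell_act; case E: (repr (chiswell_class k beta)) => [l g] /=.
have /chiswell_classP[-> lD] : chiswell_class l g = chiswell_class k beta.
  by rewrite -[RHS]reprK E.
by apply/chiswell_classP; split=> //; apply: lyndon_chiswell_mulr; rewrite -1?ltnS.
Qed.

Lemma chiswell_act_action : right_action chiswell_act.
Proof.
split=> [v|v a b]; have [k [c ->]] := chiswell_vertexP v;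
  rewrite !chiswell_act_class.
  by rewrite mulg1.
by rewrite mulgA.
Qed.

Lemma chiswell_act_adj alpha u v :
  Defs.adj u v -> Defs.adj (chiswell_act u alpha) (chiswell_act v alpha).
Proof.
suff edge_act x y : chiswell_edge x y ->
    chiswell_edge (chiswell_act x alpha) (chiswell_act y alpha).
  by move=> /asboolP uv; apply/asboolP; case: uv => /edge_act; [left|right].
move=> [k [b [-> ->]]]; exists k, (b * alpha)%g.
by rewrite !chiswell_act_class.
Qed.

Lemma depth_class k alpha :
  depth (chiswell_class k alpha : chiswell_tree theta) = k.
Proof.
have walk : walk_to_root (chiswell_class k alpha : chiswell_tree theta) k.
  case: k => k lk; elim: k lk => [|k IH] lk.
    exists [::]; split=> //=; apply/chiswell_classP.
    by split=> //; exact: val_inj.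
  have [p [pp pr ps]] := IH (ltnW lk).
  exists (chiswell_class (Ordinal (ltnW lk)) alpha :: p).
  split; rewrite /= ?ps //; apply/andP; split=> //.
  apply/asboolP; right; exists (Ordinal (lk : k < ell S)), alpha.
  by split; congr chiswell_class; apply: val_inj.
(* The level changes by one along an edge and vanishes at the root, so a walk
   from level l to the root has at least l edges. *)
have walk_ge p l b :
    path (@Defs.adj (chiswell_tree theta)) (chiswell_class l b) p ->
    last (chiswell_class l b : chiswell_tree theta) p
      = Defs.root (chiswell_tree theta) ->
    l <= size p.
  elim: p l b => [|v p IH] l b /=; first by move=> _ /chiswell_classP[->].
  have [m [c ->]] := chiswell_vertexP v => /andP[lm mp] /(IH _ _ mp) mle.
  suff: l <= m.+1 by move/leq_trans; apply.
  case/asboolP: lm => -[i [a [/chiswell_classP[-> _] /chiswell_classP[-> _]]]];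
    rewrite lift0 /=.
    by rewrite -addn2 leq_addr.
  by [].
rewrite /depth; case: ex_minnP => n /asboolP[p [pp pr <-]] /(_ k) minp.
by apply/eqP; rewrite eqn_leq (walk_ge _ _ _ pp pr) minp //; apply/asboolP.
Qed.

Lemma chiswell_act_elliptic alpha :
  `[< @elliptic (chiswell_tree theta) (chiswell_act^~ alpha) >].
Proof.
apply/asboolP; split=> [v|u v]; last exact: chiswell_act_adj.
have [k [b ->]] := chiswell_vertexP v.
by rewrite chiswell_act_class !depth_class.
Qed.

Definition chiswell_em alpha : opposite (elliptic_map (chiswell_tree theta)) :=
  EllipticMap (chiswell_act_elliptic alpha).

Fact chiswell_em_morphism : monoid_morphism chiswell_em.
Proof.
have [act1 actM] := chiswell_act_action.
split=> [|a b]; apply: val_inj; apply: funext => v; first exact: act1.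
exact: actM.
Qed.

HB.instance Definition _ :=
  isUMagmaMorphism.Build _ _ chiswell_em chiswell_em_morphism.

Lemma chiswell_em_inj : injective chiswell_em.
Proof.
move=> a b /(congr1 (fun f : elliptic_map (chiswell_tree theta) =>
  f (chiswell_class ord_max 1%g))) /=.
rewrite !chiswell_act_class !mul1g => /chiswell_classP[_].
exact: lyndon_chiswell_ell.
Qed.

End ChiswellAction.

Theorem mainTheorem2 (S : finSemigroupType) (A : finType)
    (theta : generation A S) :
  exists act : chiswell_tree theta -> adj1 (KR theta) -> chiswell_tree theta,
    [/\ forall (k : 'I_(ell S).+1) (beta alpha : adj1 (KR theta)),
          act (chiswell_class k beta) alpha = chiswell_class k (beta * alpha)%g,
        right_action act
      & exists eps : UMagmaMorphism.type (adj1 (KR theta))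
                       (opposite (elliptic_map (chiswell_tree theta))),
          injective eps /\
          forall (alpha : adj1 (KR theta)) (v : chiswell_tree theta),
            em_fun (eps alpha) v = act v alpha].
Proof.
exists (@chiswell_act A S theta); split.
- exact: chiswell_act_class.
- exact: chiswell_act_action.
- by exists (@chiswell_em A S theta); split; first exact: chiswell_em_inj.
Qed.
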